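(* Let $n \ge 1$ be an integer, let $C_n$ be the $n$-th Catalan number, let $B_{2n}$ be the $2n$-th Bernoulli number, and put $$r_n = \sqrt[4n]{2^{2n-1}|B_{2n}|} \in \mathbb{R}.$$ Then $$\zeta(2n) = \frac{\pi^{2n} r_n^{4n}}{n!\,(n+1)!\,C_n}, \qquad C_n = \frac{\pi^{2n} r_n^{4n}}{n!\,(n+1)!\,\zeta(2n)}.$$ Moreover, $\zeta(2n) = V_{4n}$, where $V_{4n}$ is the content of the hypersphere of radius $r_n$ in Euclidean space of dimension $m = 4n$ (that is, $\zeta(s) = V_{m}$ for $m = 4n$ and $s = m/2$).
   Context: The Catalan numbers are $C_n = \frac{1}{n+1}\binom{2n}{n}$. $\zeta$ is the Riemann zeta function. Bernoulli numbers are in the standard convention $\frac{t}{e^t-1} = \sum_{k\ge 0} B_k \frac{t^k}{k!}$ (so $B_2 = 1/6$). The content of a hypersphere of radius $r$ in $\mathbb{R}^m$ means the $m$-dimensional volume of the closed ball $\{x\in\mathbb{R}^m : x_1^2+\cdots+x_m^2 \le r^2\}$; for even $m$ it equals $\pi^{m/2} r^m/(m/2)!$. *)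

(* Defs.v *)
From HB Require Import structures.
From mathcomp Require Import all_boot all_order all_algebra.
From mathcomp Require Import all_classical all_reals all_analysis.

Set Implicit Arguments.
Unset Strict Implicit.
Unset Printing Implicit Defensive.

Import Order.TTheory GRing.Theory Num.Theory.
Import numFieldNormedType.Exports.

Local Open Scope classical_set_scope.
Local Open Scope ring_scope.

Definition catalan {R : realType} (n : nat) : R :=
  n.+1%:R^-1 * ('C(2 * n, n)%N)%:R.

(* Dirichlet series of the Riemann zeta function at a real argument.  [limn] is
   total, so this is zeta only where the series converges, i.e. for 1 < s. *)
Definition zeta {R : realType} (s : R) : R :=
  limn (series (fun k : nat => (k.+1%:R `^ s)^-1)).

(* t / (e^t - 1) = \sum_k B_k t^k / k! for all t close to 0; t = 0 is excluded
   because the quotient is 0 / 0 there, which evaluates to 0.  Uniqueness of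
   power series expansions makes B unique: B 0 = 1, B 1 = - 1/2, B 2 = 1/6. *)
Definition bernoulli_numbers {R : realType} (B : nat -> R) : Prop :=
  \forall t \near (0 : R)^',
    pseries (fun k => B k / k`!%:R) t @ \oo --> t / (expR t - 1).

(* The base is nonnegative, so [powR] with exponent 1/(4n) is its 4n-th root. *)
Definition bernoulli_radius {R : realType} (B : nat -> R) (n : nat) : R :=
  (2 ^+ (2 * n - 1)%N * `|B (2 * n)%N|) `^ ((4 * n)%N%:R^-1).

Section tuple_measure.
Local Open Scope ereal_scope.
Context d (T : measurableType d) (R : realType).

Definition tuple_cons m (p : T * m.-tuple T) : m.+1.-tuple T :=
  [tuple of p.1 :: p.2].

Lemma measurable_tuple_cons m : measurable_fun setT (@tuple_cons m).
Proof. exact: (@measurable_cons _ _ (T * m.-tuple T)%type T). Qed.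

Section cons_measure.
Variable m : nat.
Variable mu : {sigma_finite_measure set T -> \bar R}.
Variable nu : {sigma_finite_measure set (m.-tuple T) -> \bar R}.

Definition cons_measure : set (m.+1.-tuple T) -> \bar R :=
  pushforward (mu \x nu) (@tuple_cons m).

Let cons_measure0 : cons_measure set0 = 0.
Proof. by rewrite /cons_measure /pushforward preimage_set0 measure0. Qed.

Let cons_measure_ge0 A : 0 <= cons_measure A.
Proof. by apply: integral_ge0 => x _; exact: measure_ge0. Qed.

Let cons_measure_semi_sigma_additive : semi_sigma_additive cons_measure.
Proof.
exact: (@measure_semi_sigma_additive _ _ _
  (measure_function_pushforward__canonical__measure_function_Measure
     (mu \x nu) (@measurable_tuple_cons m))).
Qed.

HB.instance Definition _ := isMeasure.Build _ _ _ cons_measure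
  cons_measure0 cons_measure_ge0 cons_measure_semi_sigma_additive.

Lemma cons_measureE (A : set T) (B : set (m.-tuple T)) :
    measurable A -> measurable B ->
  cons_measure [set t | A (thead t) /\ B [tuple of behead t]] = mu A * nu B.
Proof.
move=> mA mB; rewrite -product_measure1E//; congr (product_measure1 _ _ _).
apply/seteqP; split => -[x t] /=; rewrite theadE.
  by move=> [Ax]; rewrite (_ : [tuple of _] = t)//; exact: val_inj.
by move=> [Ax Bt]; split => //; rewrite (_ : [tuple of _] = t)//; exact: val_inj.
Qed.

Let cons_measure_sigma_finite : sigma_finite setT cons_measure.
Proof.
have /sigma_finiteP[F [TF ndF Foo]] := sigma_finiteT mu.
have /sigma_finiteP[G [TG ndG Goo]] := sigma_finiteT nu.
exists (fun n => [set t | F n (thead t) /\ G n [tuple of behead t]]).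
  apply/esym/seteqP; split => // t _.
  have [i _ Fi] : (\bigcup_i F i) (thead t) by rewrite -TF.
  have [j _ Gj] : (\bigcup_i G i) [tuple of behead t] by rewrite -TG.
  exists (maxn i j) => //; split.
  - by move: Fi; exact/subsetPset/ndF/leq_maxl.
  - by move: Gj; exact/subsetPset/ndG/leq_maxr.
move=> k; have [mF Fk] := Foo k; have [mG Gk] := Goo k.
split; last by rewrite cons_measureE// lte_mul_pinfty// ge0_fin_numE.
apply: measurableI.
  by rewrite -[X in measurable X]setTI; exact: measurable_tnth.
by rewrite -[X in measurable X]setTI; exact: measurable_behead.
Qed.

HB.instance Definition _ := Measure_isSigmaFinite.Build _ _ _ cons_measure
  cons_measure_sigma_finite.
End cons_measure.

(* m-fold product measure, characterized on boxes by [tuple_measure_box]. *)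
Fixpoint tuple_measure (mu : {sigma_finite_measure set T -> \bar R}) m :
    {sigma_finite_measure set (m.-tuple T) -> \bar R} :=
  match m with
  | 0%N => \d_ ([tuple] : 0.-tuple T)
  | m'.+1 => cons_measure mu (tuple_measure mu m')
  end.

Lemma tuple_measure_box (mu : {sigma_finite_measure set T -> \bar R}) m
    (A : 'I_m -> set T) : (forall i, measurable (A i)) ->
  tuple_measure mu m [set t | forall i, A i (tnth t i)] = \prod_(i < m) mu (A i).
Proof.
elim: m A => [|m IH] A mA /=.
  by rewrite big_ord0 diracE mem_set// => -[].
rewrite big_ord_recl -IH// -cons_measureE//; last first.
  rewrite [X in measurable X](_ : _ =
      \bigcap_(i in [set: 'I_m]) ((fun t => tnth t i) @^-1` A (lift ord0 i))).
    apply: fin_bigcap_measurable => // i _.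
    by rewrite -[X in measurable X]setTI; exact: measurable_tnth.
  by apply/seteqP; split => t /= h i; [move=> _|]; exact: h.
congr (cons_measure _ _ _); apply/seteqP; split => t /=.
  move=> h; split => [|i]; first exact: h.
  by rewrite -(tnthS (thead t)) -tuple_eta; exact: h.
move=> [h0 h] i; case: (unliftP ord0 i) => [j ->|->//].
by rewrite (tuple_eta t) tnthS; exact: h.
Qed.

End tuple_measure.

(* Lebesgue measure on R^m, with R^m represented by m-tuples. *)
Definition lebesgue_tuple {R : realType} (m : nat) :
    {sigma_finite_measure set (m.-tuple (measurableTypeR R)) -> \bar R} :=
  tuple_measure (@lebesgue_measure R) m.

Definition closed_euclidean_ball {R : realType} {m : nat} (r : R) :
    set (m.-tuple (measurableTypeR R)) :=
  [set x | \sum_(i < m) (tnth x i : R) ^+ 2 <= r ^+ 2].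

(* Main.v *)
(* Since [n! (n+1)! C_n = (2n)!], everything reduces to Euler's formula
   [zeta(2n) = (2 pi)^(2n) |B_(2n)| / (2 (2n)!)] and to the volume
   [pi^m r^(2m) / m!] of the ball in dimension [2m].

   Euler's formula: splitting [1 / (y^2 - x^2)] into partial fractions in the
   off-diagonal part of the product of truncated zeta sums gives (Williams)
   [\sum_(0 < i < n) zeta(2i) zeta(2n - 2i) = (n + 1/2) zeta(2n)], while the
   differential equation of [t / (e^t - 1)] gives the same recurrence, up to the
   factor [- (-1)^n (2 pi)^(2n) / 2], for [B_(2n) / (2n)!].  The initial value
   [zeta(2) = pi^2 / 6] comes from summing [1/sin^2 x - 1 <= 1/x^2 <= 1/sin^2 x]
   over the points [(2k+1) pi / 2^(n+2)] (Hofbauer).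

   Volume: slicing by the first coordinate multiplies the volume constant in
   dimension [m] by the integral of [sqrt (1 - x^2)^m] over [[-1, 1]], and the
   product of two consecutive such integrals is [2 pi / (m + 2)]. *)
Require Import Defs.
From HB Require Import structures.
From mathcomp Require Import all_boot all_order all_algebra.
From mathcomp Require Import all_classical all_reals all_analysis.
From mathcomp Require Import ring lra zify.

Set Implicit Arguments.
Unset Strict Implicit.
Unset Printing Implicit Defensive.

Import Order.TTheory GRing.Theory Num.Theory.
Import numFieldNormedType.Exports.

Local Open Scope classical_set_scope.
Local Open Scope ring_scope.

(** * Volume of balls *)

(** The derivative is asked for only inside the interval, because [half_chord r] has vertical
    tangents at the end points. *)
Lemma Rintegral_FTC2 {R : realType} (f F : R -> R) (a b : R) : a < b ->
  continuous f -> continuous F ->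
  (forall x, a < x < b -> is_derive x 1 F (f x)) ->
  \int[lebesgue_measure]_(x in `[a, b]) f x = F b - F a.
Proof.
move=> ab cf cF dF; rewrite /Rintegral (@continuous_FTC2 _ f F)//.
- exact: continuous_subspaceT.
- split.
  + by move=> x; rewrite in_itv/= => /dF xab; exact: ex_derive.
  + exact/cvg_at_right_filter/cF.
  + exact/cvg_at_left_filter/cF.
- by move=> x; rewrite in_itv/= => /dF xab; rewrite derive1E derive_val.
Qed.

(** Radius of the slice of the ball of radius [r] at abscissa [x]. As [Num.sqrt] is 0 on negative
    reals, it is continuous on the whole line. *)
Definition half_chord {R : realType} (r x : R) : R := Num.sqrt (r ^+ 2 - x ^+ 2).

Lemma continuous_half_chord {R : realType} (r : R) : continuous (half_chord r).
Proof.
move=> x; apply: (@continuous_comp R R R (fun x => r ^+ 2 - x ^+ 2) (@Num.sqrt R)).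
  by apply: cvgB; [exact: cvg_cst|exact: exprn_continuous].
exact: sqrt_continuous.
Qed.

Lemma continuous_half_chordX {R : realType} (r : R) n :
  continuous (fun x => half_chord r x ^+ n).
Proof.
move=> x; apply: (@continuous_comp R R R (half_chord r) (fun y => y ^+ n)).
  exact: continuous_half_chord.
exact: exprn_continuous.
Qed.

Lemma half_chord_gt0 {R : realType} (r x : R) : - r < x < r -> 0 < half_chord r x.
Proof. by move=> /andP[rx xr]; rewrite sqrtr_gt0; nra. Qed.

Lemma half_chord_sqr {R : realType} (r x : R) : - r <= x <= r ->
  half_chord r x ^+ 2 = r ^+ 2 - x ^+ 2.
Proof. by move=> /andP[rx xr]; rewrite sqr_sqrtr//; nra. Qed.

Lemma half_chord_end {R : realType} (r : R) : half_chord r r = 0.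
Proof. by rewrite /half_chord subrr sqrtr0. Qed.

Lemma half_chordN {R : realType} (r x : R) : half_chord r (- x) = half_chord r x.
Proof. by rewrite /half_chord sqrrN. Qed.

Lemma is_derive_half_chord {R : realType} (r x : R) : - r < x < r ->
  is_derive x 1 (half_chord r) (- x / half_chord r x).
Proof.
move=> xr; have s0 := half_chord_gt0 xr.
have d : is_derive x 1 (fun x => r ^+ 2 - x ^+ 2) (- (2 * x)).
  by apply: is_derive_eq; rewrite /GRing.scale/=; ring.
have e : 0 < r ^+ 2 - x ^+ 2 by rewrite -sqrtr_gt0.
have := @is_derive1_comp _ _ (fun x => r ^+ 2 - x ^+ 2) x _ _ (is_derive1_sqrt e) d.
move=> h; apply: (@is_derive_eq _ _ _ (half_chord r) _ _ _ _ h).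
by rewrite -/(half_chord r x); field; rewrite gt_eqF.
Qed.

(** For [r = 1], the substitution [x = sin u] turns this into the Wallis integral of
    [cos u ^ (m + 1)] over [[- pi / 2, pi / 2]]. *)
Definition chord_integral {R : realType} (m : nat) (r : R) : R :=
  \int[lebesgue_measure]_(x in `[- r, r]) half_chord r x ^+ m.

Lemma chord_integral0 {R : realType} (r : R) : 0 < r ->
  chord_integral 0 r = 2 * r.
Proof.
move=> r0; rewrite /chord_integral (@Rintegral_FTC2 _ _ id).
- by ring.
- by lra.
- by move=> x; exact: cvg_cst.
- by move=> x; exact: cvg_id.
Qed.

(* [2 * atan (x / (r + sqrt (r^2 - x^2)))] is [asin (x / r)], written so that it
   is visibly continuous up to the end points of the interval. *)
Lemma chord_integral1 {R : realType} (r : R) : 0 < r ->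
  chord_integral 1 r = pi / 2 * r ^+ 2.
Proof.
move=> r0.
have den x : r + half_chord r x != 0 by rewrite gt_eqF// ltr_pwDl// sqrtr_ge0.
pose F x : R := x * half_chord r x / 2 + r ^+ 2 * atan (x / (r + half_chord r x)).
have dF x : - r < x < r -> is_derive x 1 F (half_chord r x ^+ 1).
  move=> xr.
  have s0 := half_chord_gt0 xr.
  have ss : half_chord r x ^+ 2 = r ^+ 2 - x ^+ 2.
    by apply: half_chord_sqr; case/andP: xr => *; rewrite !ltW.
  have ds := is_derive_half_chord xr.
  have d1 : is_derive x 1 (fun x => x * half_chord r x / 2)
      ((half_chord r x - x ^+ 2 / half_chord r x) / 2).
    apply: is_derive_eq; rewrite /GRing.scale/=.
    by field; rewrite gt_eqF.
  have dV : is_derive x 1 (fun x => (r + half_chord r x)^-1)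
      (x / half_chord r x / (r + half_chord r x) ^+ 2).
    have d : is_derive x 1 (fun x => r + half_chord r x) (- x / half_chord r x).
      by apply: is_derive_eq; rewrite add0r mul1r.
    have h := @is_deriveV _ (fun x => r + half_chord r x) x _ _ (den x) d.
    apply: (@is_derive_eq _ _ _ _ _ _ _ _ h); rewrite /GRing.scale/=.
    by field; rewrite den gt_eqF.
  have du : is_derive x 1 (fun x => x / (r + half_chord r x))
      ((r + half_chord r x)^-1 + x ^+ 2 / half_chord r x / (r + half_chord r x) ^+ 2).
    apply: is_derive_eq; rewrite /GRing.scale/=.
    by field; rewrite den gt_eqF.
  have da := is_derive1_comp (is_derive1_atan _) du.
  have := @is_deriveD _ _ _ _ _ _ _ _ _ d1
     (@is_deriveZ _ _ _ _ (r ^+ 2) _ _ _ da).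
  move=> h; apply: (@is_derive_eq _ _ _ _ _ _ _ _ h).
  rewrite /GRing.scale/= expr1.
  have -> : x ^+ 2 = (r ^+ 2 - half_chord r x ^+ 2) by rewrite ss; ring.
  (* With [s = half_chord r x], the identity [x^2 = r^2 - s^2] gives
     [(r + s)^2 + x^2 = 2 r (r + s)]. *)
  have -> : 1 + (x / (r + half_chord r x)) ^+ 2 = 2 * r / (r + half_chord r x).
    rewrite expr_div_n.
    have -> : x ^+ 2 = (r ^+ 2 - half_chord r x ^+ 2) by rewrite ss; ring.
    by field; rewrite den.
  by field; rewrite den !gt_eqF.
rewrite /chord_integral (Rintegral_FTC2 _ _ _ dF).
- rewrite /F half_chordN half_chord_end addr0.
  have rr : r / r = 1 by apply: divff; rewrite gt_eqF.
  have rNr : - r / r = - 1 by rewrite mulNr rr.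
  by rewrite rr rNr atanN atan1; field.
- by lra.
- exact: continuous_half_chordX.
- move=> x; apply: cvgD.
    apply: cvgM; last exact: cvg_cst.
    by apply: cvgM; [exact: cvg_id|exact: continuous_half_chord].
  apply: cvgM; first exact: cvg_cst.
  apply: (@continuous_comp R R R (fun x => x / (r + half_chord r x)) atan).
    apply: cvgM; first exact: cvg_id.
    apply: cvgV => //; apply: cvgD; first exact: cvg_cst.
    exact: continuous_half_chord.
  exact: continuous_atan.
Qed.

(** The difference of the two integrands is the derivative of [x * half_chord r x ^+ m.+2], which
    vanishes at both end points. *)
Lemma chord_integral_rec {R : realType} m (r : R) : 0 < r ->
  m.+3%:R * chord_integral m.+2 r = m.+2%:R * r ^+ 2 * chord_integral m r.
Proof.
move=> r0; rewrite /chord_integral.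
have int k : lebesgue_measure.-integrable `[- r, r]
    (EFin \o (fun x => half_chord r x ^+ k)).
  apply: continuous_compact_integrable; first exact: segment_compact.
  exact/continuous_subspaceT/continuous_half_chordX.
have intZ c k : lebesgue_measure.-integrable `[- r, r]
    (EFin \o (fun x => c * half_chord r x ^+ k)).
  apply: continuous_compact_integrable; first exact: segment_compact.
  apply/continuous_subspaceT => x; apply: cvgM; first exact: cvg_cst.
  exact: continuous_half_chordX.
rewrite -!RintegralZl//; apply/eqP; rewrite -subr_eq0 -RintegralB//.
have dF x : - r < x < r -> is_derive x 1 (fun x => x * half_chord r x ^+ m.+2)
    (m.+3%:R * half_chord r x ^+ m.+2 - m.+2%:R * r ^+ 2 * half_chord r x ^+ m).
  move=> xr.
  have s0 := half_chord_gt0 xr.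
  have ss : half_chord r x ^+ 2 = r ^+ 2 - x ^+ 2.
    by apply: half_chord_sqr; case/andP: xr => *; rewrite !ltW.
  have ds := is_derive_half_chord xr.
  have dX := @is_deriveX _ _ (half_chord r) m.+2 x 1 _ ds.
  have dM := @is_deriveM _ _ id _ _ _ _ _ (is_derive_id x 1) dX.
  have <- : id * half_chord r ^+ m.+2 = fun x => x * half_chord r x ^+ m.+2.
    by apply/funext => y; rewrite !fctE.
  apply: (@is_derive_eq _ _ _ _ _ _ _ _ dM); rewrite /GRing.scale/= !fctE.
  have -> : r ^+ 2 = half_chord r x ^+ 2 + x ^+ 2 by rewrite ss; ring.
  rewrite !exprS -!natr1; field; rewrite gt_eqF//.
rewrite (Rintegral_FTC2 _ _ _ dF).
- by rewrite half_chordN half_chord_end expr0n !mulr0 subrr.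
- by lra.
- by move=> x; apply: cvgB; (apply: cvgM; first exact: cvg_cst);
    exact: continuous_half_chordX.
- by move=> x; apply: cvgM; [exact: cvg_id|exact: continuous_half_chordX].
Qed.

(** Obtained from the recurrence instead of a change of variables; two consecutive exponents are
    carried along because the recurrence advances by two. *)
Lemma chord_integral_scale {R : realType} m (r : R) : 0 <= r ->
  chord_integral m r = chord_integral m 1 * r ^+ m.+1.
Proof.
rewrite le_eqVlt => /predU1P[<-|r0].
  by rewrite /chord_integral oppr0 set_itv1 Rintegral_set1 expr0n mulr0.
have [] // : chord_integral m r = chord_integral m 1 * r ^+ m.+1 /\
    chord_integral m.+1 r = chord_integral m.+1 1 * r ^+ m.+2.
elim: m => [|m [IH0 IH1]].
  rewrite !chord_integral0// !chord_integral1//.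
  by split; ring.
split=> //; apply: (@mulfI _ m.+3%:R); first by rewrite pnatr_eq0.
rewrite mulrA !chord_integral_rec// IH0 expr1n mulr1 !exprS.
by ring.
Qed.

(** By the recurrence, passing from [m] to [m.+1] multiplies the product by [(m + 2) / (m + 3)]. *)
Lemma chord_integral_mulS {R : realType} m :
  chord_integral m 1 * chord_integral m.+1 1 = 2 * pi / m.+2%:R :> R.
Proof.
elim: m => [|m IH].
  by rewrite chord_integral0// chord_integral1//; field.
have := @chord_integral_rec R m 1 ltr01; rewrite expr1n mulr1 => h.
have m3 : m.+3%:R != 0 :> R by rewrite pnatr_eq0.
have -> : chord_integral m.+2 1 = m.+2%:R * chord_integral m 1 / m.+3%:R :> R.
  by rewrite -h mulrAC mulfV// mul1r.
transitivity (m.+2%:R / m.+3%:R * (chord_integral m 1 * chord_integral m.+1 1) : R).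
  by ring.
by rewrite IH; field; rewrite -!natrD !pnatr_eq0.
Qed.

Lemma closed_euclidean_ball_cons {R : realType} m (r : R) x
    (t : m.-tuple (measurableTypeR R)) :
  closed_euclidean_ball r (tuple_cons (x, t)) =
  (x ^+ 2 + \sum_(i < m) (tnth t i : R) ^+ 2 <= r ^+ 2) :> Prop.
Proof.
rewrite /closed_euclidean_ball/= big_ord_recl (tnth_nth 0)/=.
by under eq_bigr do rewrite (tnth_nth 0)/= -tnth_nth.
Qed.

(** The slice at [x] is a ball of radius [half_chord r x] if [- r <= x <= r] and is empty otherwise,
    so the induction is over all radii at once. *)
Lemma lebesgue_ball {R : realType} m (r : R) : 0 <= r ->
  lebesgue_tuple m (closed_euclidean_ball r) =
  ((\prod_(k < m) chord_integral k 1) * r ^+ m)%:E.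
Proof.
elim: m r => [|m IH] r r0.
  rewrite big_ord0 mul1r expr0 /lebesgue_tuple/= diracE mem_set//=.
  by rewrite /closed_euclidean_ball/= big_ord0 sqr_ge0.
rewrite big_ord_recr/=.
set c := \prod_(k < m) _ in IH *.
(* Holds by computation: the product measure is defined as the integral of the measures of the
   sections. *)
have -> : lebesgue_tuple m.+1 (closed_euclidean_ball r) =
    (\int[@lebesgue_measure R]_x lebesgue_tuple m
      (xsection (@tuple_cons _ _ m @^-1` closed_euclidean_ball r) x))%E.
  by [].
transitivity
  (\int[@lebesgue_measure R]_(x in `[(- r)%R, r]) (c * half_chord r x ^+ m)%R%:E)%E.
  rewrite [RHS]integral_mkcond; apply: eq_integral => x _.
  rewrite patchE; case: ifPn => [|/negP xr].
    rewrite inE/= in_itv/= => xr.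
    rewrite -IH ?sqrtr_ge0//; congr (lebesgue_tuple m _).
    apply/seteqP; split => t; rewrite /xsection/= inE/=;
      rewrite closed_euclidean_ball_cons /closed_euclidean_ball/=;
      rewrite half_chord_sqr// => h; lra.
  rewrite (_ : xsection _ _ = set0) ?measure0//.
  apply/seteqP; split => t //; rewrite /xsection/= inE/=.
  rewrite closed_euclidean_ball_cons => h; apply: xr; rewrite inE/= in_itv/=.
  have : x ^+ 2 <= r ^+ 2.
    by apply: le_trans h; rewrite lerDl sumr_ge0// => i _; exact: sqr_ge0.
  by rewrite -[x ^+ 2]real_normK ?num_real// ler_pXn2r ?nnegrE// ler_norml.
have int k d : lebesgue_measure.-integrable `[- r, r]
    (EFin \o (fun x => d * half_chord r x ^+ k)).
  apply: continuous_compact_integrable; first exact: segment_compact.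
  apply/continuous_subspaceT => x; apply: cvgM; first exact: cvg_cst.
  exact: continuous_half_chordX.
rewrite -[LHS]fineK; last by apply: integrable_fin_num => //; exact: int.
congr EFin; rewrite -/(Rintegral _ _ _) RintegralZl//; last first.
  apply: continuous_compact_integrable; first exact: segment_compact.
  exact/continuous_subspaceT/continuous_half_chordX.
by rewrite -/(chord_integral m r) chord_integral_scale// mulrA.
Qed.

(** The factors of indices [2m] and [2m + 1] multiply to [pi / (m + 1)]. *)
Lemma lebesgue_ball_even {R : realType} m (r : R) : 0 <= r ->
  lebesgue_tuple (2 * m) (closed_euclidean_ball r) =
  (pi ^+ m * r ^+ (2 * m) / m`!%:R)%:E.
Proof.
move=> r0; rewrite lebesgue_ball//; congr EFin.
rewrite mulrAC; congr (_ * _); elim: m => [|m IH].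
  by rewrite muln0 big_ord0 expr0 fact0 divr1.
rewrite mulnS !big_ord_recr/= IH -mulrA chord_integral_mulS.
rewrite factS natrM exprS (_ : (2 * m).+2 = 2 * m.+1)%N; last by rewrite mulnS.
by rewrite natrM; field; rewrite addrC natr1 !pnatr_eq0 -lt0n fact_gt0.
Qed.

(** * The value of zeta at 2 *)

Lemma sin_le_id {R : realType} (x : R) : 0 <= x -> sin x <= x.
Proof.
move=> x0; have [c _ ] := @MVT_segment R (@sin R) (@cos R) 0 x x0
  (fun _ _ => is_derive_sin _) (continuous_subspaceT (@continuous_sin R)).
rewrite sin0 !subr0 => ->; rewrite -[leRHS]mul1r ler_wpM2r// cos_le1//.
Qed.

Lemma id_mul_cos_le_sin {R : realType} (x : R) : 0 <= x <= pi -> x * cos x <= sin x.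
Proof.
move=> /andP[x0 xpi].
have d (y : R) : is_derive y 1 (fun y : R => sin y - y * cos y) (y * sin y).
  by apply: is_derive_eq; rewrite /GRing.scale/=; ring.
have c : continuous (fun y : R => sin y - y * cos y).
  move=> y; apply: cvgB; first exact: continuous_sin.
  by apply: cvgM; [exact: cvg_id|exact: continuous_cos].
have [c' /[!in_itv]/= /andP[c0 cx]] :=
  MVT_segment x0 (fun y _ => d y) (continuous_subspaceT c).
rewrite sin0 mul0r !subr0 => e; rewrite -subr_ge0 e !mulr_ge0//.
by rewrite sin_ge0_pi// c0 (le_trans cx).
Qed.

(** The left member is [cot x ^ 2], so the bounds are the squares of
    [cot x <= 1 / x <= 1 / sin x]. *)
Lemma sqr_inv_sin_bounds {R : realType} (x : R) : 0 < x < pi / 2 ->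
  (sin x ^+ 2)^-1 - 1 <= (x ^+ 2)^-1 <= (sin x ^+ 2)^-1.
Proof.
move=> /andP[x0 xpi]; have p0 := @pi_gt0 R.
have s0 : 0 < sin x by apply: sin_gt0_pihalf; rewrite x0.
have c0 : 0 < cos x by apply: cos_gt0_pihalf; rewrite xpi andbT; lra.
have sx : sin x <= x by apply: sin_le_id; exact: ltW.
have xs : x * cos x <= sin x by apply: id_mul_cos_le_sin; lra.
apply/andP; split; last first.
  by rewrite lef_pV2 ?posrE ?exprn_gt0// ler_pXn2r ?nnegrE// ltW.
have -> : (sin x ^+ 2)^-1 - 1 = (cos x / sin x) ^+ 2.
  rewrite expr_div_n cos2sin2; field; exact: lt0r_neq0.
have h : cos x / sin x <= x^-1.
  by rewrite ler_pdivrMr// mulrC ler_pdivlMr// mulrC.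
by rewrite -exprVn ler_pXn2r ?nnegrE ?invr_ge0 ?(ltW x0)// divr_ge0// ltW.
Qed.

Lemma sqr_inv_sin_double {R : realType} (y : R) : sin y != 0 -> cos y != 0 ->
  (sin y ^+ 2)^-1 + (cos y ^+ 2)^-1 = 4 * (sin (y *+ 2) ^+ 2)^-1.
Proof.
move=> s0 c0; rewrite sin_mulr2n -mulr_natr.
have -> : (sin y ^+ 2)^-1 + (cos y ^+ 2)^-1 = (cos y ^+ 2 + sin y ^+ 2) / (sin y * cos y) ^+ 2.
  by field; rewrite s0 c0.
by rewrite cos2Dsin2; field; rewrite s0 c0.
Qed.

(** In the sum for [n + 1], the angles of indices [k] and [2^(n+1) - 1 - k] add up to [pi / 2]. Such
    a pair contributes [1/sin^2 + 1/cos^2], which is 4 times the term of index [k] in the sum for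
    [n]. *)
Lemma sum_sqr_inv_sin {R : realType} n :
  \sum_(k < 2 ^ n) (sin (k.*2.+1%:R * (pi / (2 ^ n.+2)%:R)) ^+ 2)^-1 =
  2 * 4 ^+ n :> R.
Proof.
elim: n => [|n IH].
  rewrite expn0 big_ord1 expr0 mulr1 mul1r.
  have e : (pi / 4 : R) *+ 2 = pi / 2 by rewrite -mulr_natr; field.
  have := cos_mulr2n (pi / 4 : R).
  rewrite e cos_pihalf cos2sin2 => h.
  have -> : sin (pi / (2 ^ 2)%:R) ^+ 2 = 2^-1 :> R by lra.
  by rewrite invrK.
set d : R := pi / (2 ^ n.+3)%:R.
have e2 : (2 ^ n.+3)%:R != 0 :> R by rewrite pnatr_eq0 expn_eq0.
have d0 : 0 < d by rewrite divr_gt0 ?pi_gt0// ltr0n expn_gt0.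
have dpi : (2 ^ n.+2)%:R * d = pi / 2.
  by rewrite /d (expnS _ n.+2) natrM; field.
have bnd (k : 'I_(2 ^ n)) : 0 < k.*2.+1%:R * d < pi / 2.
  rewrite mulr_gt0//= -dpi ltr_pM2r// ltr_nat.
  by rewrite !expnS mul2n -mul2n; have := ltn_ord k; lia.
have -> : (2 ^ n.+1 = 2 ^ n + 2 ^ n)%N by rewrite expnS mul2n addnn.
rewrite big_split_ord/= [X in _ + X](reindex_inj rev_ord_inj)/= -big_split/=.
rewrite exprS mulrCA -IH mulr_sumr; apply: eq_bigr => k _.
have -> : (2 ^ n + (2 ^ n - k.+1)).*2.+1%:R * d = pi / 2 - k.*2.+1%:R * d.
  have -> : pi / 2 = (2 ^ n.+2)%:R * d by rewrite dpi.
  rewrite -mulrBl -natrB; last by rewrite !expnS; have := ltn_ord k; lia.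
  by congr (_%:R * _); rewrite !expnS; have := ltn_ord k; lia.
rewrite sinB sin_pihalf cos_pihalf mul0r subr0 mul1r sqr_inv_sin_double.
- congr (_ * (sin _ ^+ 2)^-1).
  by rewrite /d (expnS _ n.+2) natrM -mulr_natr; field.
- by rewrite lt0r_neq0// sin_gt0_pihalf.
- rewrite lt0r_neq0// cos_gt0_pihalf//; have /andP[kd ->] := bnd k.
  by rewrite andbT (lt_trans _ kd)// oppr_lt0 divr_gt0 ?pi_gt0.
Qed.

Definition zeta_sum {R : realType} (p N : nat) : R := \sum_(k < N) (k.+1%:R ^+ p)^-1.

Lemma zeta_sum_homo {R : realType} p :
  {homo @zeta_sum R p : n m / (n <= m)%N >-> n <= m}.
Proof.
apply: homo_leq => [//|x y z|n]; first exact: le_trans.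
by rewrite /zeta_sum big_ord_recr/= lerDl invr_ge0 exprn_ge0.
Qed.

Lemma zeta_sum_le2 {R : realType} p N : (2 <= p)%N -> zeta_sum p N <= 2 :> R.
Proof.
move=> p2; case: N => [|N]; first by rewrite /zeta_sum big_ord0.
(* This sharper bound is inductive: the next term is at most [1 / ((N+1)(N+2))], which
   telescopes. *)
suff : zeta_sum p N.+1 <= 2 - N.+1%:R^-1 :> R.
  by move/le_trans; apply; rewrite gerBl invr_ge0.
elim: N => [|N IH].
  by rewrite /zeta_sum big_ord1 expr1n invr1; lra.
rewrite /zeta_sum big_ord_recr/=; apply: (le_trans (lerD IH (lexx _))).
have a0 : 0 < N.+1%:R :> R by [].
have : (N.+2%:R ^+ p)^-1 <= (N.+1%:R * N.+2%:R)^-1 :> R.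
  rewrite lef_pV2 ?posrE ?exprn_gt0 ?mulr_gt0//.
  apply: (@le_trans _ _ (N.+2%:R ^+ 2)).
    by rewrite expr2 ler_pM2r// ler_nat.
  by rewrite ler_weXn2l// ler1n.
have -> : (N.+1%:R * N.+2%:R)^-1 = N.+1%:R^-1 - N.+2%:R^-1 :> R.
  by rewrite -(natr1 N.+1); field; rewrite !gt_eqF//; lra.
by move=> h; apply: (le_trans (lerD (lexx _) h)); rewrite addrA subrK.
Qed.

Lemma is_cvg_zeta_sum {R : realType} p : (2 <= p)%N -> cvgn (@zeta_sum R p).
Proof.
move=> p2; apply: nondecreasing_is_cvgn; first exact: zeta_sum_homo.
by exists 2 => _ [N _ <-]; exact: zeta_sum_le2.
Qed.

Lemma zeta_natE {R : realType} p : zeta p%:R = limn (@zeta_sum R p).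
Proof.
rewrite /zeta; congr (limn _); apply/funext => N.
rewrite /series/= big_mkord; apply: eq_bigr => k _.
by rewrite powR_mulrn.
Qed.

Lemma cvg_zeta_sum {R : realType} p : (2 <= p)%N ->
  @zeta_sum R p @ \oo --> @zeta R p%:R.
Proof. by move=> p2; rewrite zeta_natE; exact: is_cvg_zeta_sum. Qed.

Lemma zeta_ge1 {R : realType} p : (2 <= p)%N -> 1 <= zeta p%:R :> R.
Proof.
move=> p2; rewrite zeta_natE.
have <- : zeta_sum p 1 = 1 :> R by rewrite /zeta_sum big_ord1 expr1n invr1.
apply: nondecreasing_cvgn_le; [exact: zeta_sum_homo|exact: is_cvg_zeta_sum].
Qed.

Definition odd_zeta_sum {R : realType} (N : nat) : R :=
  \sum_(k < N) (k.*2.+1%:R ^+ 2)^-1.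

Lemma zeta_sum_double {R : realType} N :
  zeta_sum 2 N.*2 = odd_zeta_sum N + zeta_sum 2 N / 4 :> R.
Proof.
elim: N => [|N IH]; first by rewrite /zeta_sum /odd_zeta_sum !big_ord0 mul0r addr0.
move: IH; rewrite /zeta_sum /odd_zeta_sum doubleS !big_ord_recr/= => ->.
have -> : N.*2.+2%:R = N.+1%:R * 2 :> R by rewrite -natrM muln2.
by rewrite exprMn; field; rewrite !(addrC 1) !natr1 !pnatr_eq0.
Qed.

(** Sums [sqr_inv_sin_bounds] over the [M = 2^n] points [(2k+1) d] and scales by
    [d^2 = pi^2 / (16 M^2)]. The main part [2 M^2] becomes [pi^2 / 8], and the [M] subtracted ones
    become the error [pi^2 / (16 M)]. *)
Lemma odd_zeta_sum_bounds {R : realType} n :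
  @pi R ^+ 2 / 8 - pi ^+ 2 / 16 / 2 ^+ n <= odd_zeta_sum (2 ^ n) <= @pi R ^+ 2 / 8.
Proof.
set M := (2 ^ n)%N.
have M0 : 0 < M%:R :> R by rewrite ltr0n expn_gt0.
have p0 := @pi_gt0 R.
pose d : R := pi / (2 ^ n.+2)%:R.
have dE : d = pi / (4 * M%:R) by rewrite /d !expnS mulnA natrM.
have d0 : 0 < d by rewrite dE divr_gt0// mulr_gt0.
have bnd (k : 'I_M) : 0 < k.*2.+1%:R * d < pi / 2.
  rewrite mulr_gt0//= dE mulrA ltr_pdivrMr ?mulr_gt0//.
  rewrite [ltRHS](_ : _ = M.*2%:R * pi); last by rewrite -muln2 natrM; field.
  by rewrite ltr_pM2r// ltr_nat; have := ltn_ord k; lia.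
have sinS : \sum_(k < M) (sin (k.*2.+1%:R * d) ^+ 2)^-1 = 2 * M%:R ^+ 2 :> R.
  by rewrite sum_sqr_inv_sin /M natrX -exprM mulnC exprM; congr (_ * _ ^+ n); ring.
have oE : odd_zeta_sum M = d ^+ 2 * \sum_(k < M) ((k.*2.+1%:R * d) ^+ 2)^-1 :> R.
  rewrite mulr_sumr; apply: eq_bigr => k _.
  by field; rewrite gt_eqF// addrC natr1 pnatr_eq0.
have lo : 2 * M%:R ^+ 2 - M%:R <= \sum_(k < M) ((k.*2.+1%:R * d) ^+ 2)^-1.
  rewrite -sinS -[X in _ - X%:R](card_ord M) -sumr_const -sumrB.
  by apply: ler_sum => k _; have /andP[] := sqr_inv_sin_bounds (bnd k).
have hi : \sum_(k < M) ((k.*2.+1%:R * d) ^+ 2)^-1 <= 2 * M%:R ^+ 2.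
  rewrite -sinS.
  by apply: ler_sum => k _; have /andP[] := sqr_inv_sin_bounds (bnd k).
have d2 : 0 <= d ^+ 2 by exact: sqr_ge0.
rewrite oE; apply/andP; split.
  apply: le_trans (ler_wpM2l d2 lo); rewrite dE -natrX -/M le_eqVlt; apply/orP; left.
  by apply/eqP; field; rewrite gt_eqF.
apply: (le_trans (ler_wpM2l d2 hi)); rewrite dE le_eqVlt; apply/orP; left.
by apply/eqP; field; rewrite gt_eqF.
Qed.

(** In the limit along powers of two, splitting into odd and even terms gives
    [z = pi^2 / 8 + z / 4]. *)
Lemma zeta2 {R : realType} : zeta 2%:R = pi ^+ 2 / 6 :> R.
Proof.
have c2 : (fun n => zeta_sum 2 (2 ^ n)) @ \oo --> @zeta R 2%:R.
  apply: (@cvg_comp _ _ _ (fun n => 2 ^ n)%N (@zeta_sum R 2)); last exact: cvg_zeta_sum.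
  apply: (@cvgnyPge _ _ _ _).2 => A; exists A => // n/= An.
  by rewrite (leq_trans An)// ltnW// ltn_expl.
have c3 : (fun n => zeta_sum 2 (2 ^ n.+1)) @ \oo --> @zeta R 2%:R.
  by apply: (cvg_comp _ _ (@cvg_addnl 1) c2).
have co : (fun n => odd_zeta_sum (2 ^ n)) @ \oo --> (pi ^+ 2 / 8 : R).
  apply: (@squeeze_cvgr _ _ _ _ (fun n => pi ^+ 2 / 8 - pi ^+ 2 / 16 / 2 ^+ n)
    (fun=> pi ^+ 2 / 8)).
  - by near=> n; exact: odd_zeta_sum_bounds.
  - rewrite -[X in _ --> X]subr0; apply: cvgB; first exact: cvg_cst.
    rewrite -[X in _ --> X](mulr0 (pi ^+ 2 / 16)).
    apply: cvgM; first exact: cvg_cst.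
    have := @cvg_geometric R 1 2^-1; rewrite ger0_norm// invf_lt1// ltr1n => /(_ isT).
    by apply: cvg_trans; apply: near_eq_cvg; near=> n; rewrite /geometric/= mul1r exprVn.
  - exact: cvg_cst.
have c4 : (fun n => zeta_sum 2 (2 ^ n.+1)) @ \oo --> pi ^+ 2 / 8 + @zeta R 2%:R / 4.
  rewrite (_ : (fun n => _) = fun n => odd_zeta_sum (2 ^ n) + zeta_sum 2 (2 ^ n) / 4).
    by apply: cvgD => //; apply: cvgM => //; exact: cvg_cst.
  by apply/funext => n; rewrite expnS mul2n zeta_sum_double.
have h : @zeta R 2%:R = pi ^+ 2 / 8 + zeta 2%:R / 4.
  by apply: (cvg_unique _ c3 c4).
by move: (zeta _) h => z h; lra.
Unshelve. all: by end_near. Qed.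

(** * A quadratic recurrence for zeta at even integers *)

Definition harmonic_sum {R : realType} (N : nat) : R := \sum_(k < N) k.+1%:R^-1.

Lemma harmonic_sumD {R : realType} m n :
  harmonic_sum (m + n) = harmonic_sum m + \sum_(k < n) (m + k).+1%:R^-1 :> R.
Proof. by rewrite /harmonic_sum big_split_ord. Qed.

Lemma harmonic_sumD_bounds {R : realType} m n :
  0 <= harmonic_sum (m + n) - @harmonic_sum R m <= n%:R / m.+1%:R.
Proof.
rewrite harmonic_sumD addrAC subrr add0r; apply/andP; split.
  by apply: sumr_ge0 => k _; rewrite invr_ge0.
rewrite -[X in X%:R / _](card_ord n) -mulr_natl mulr1 mulr_natl -sumr_const.
by apply: ler_sum => k _; rewrite lef_pV2 ?posrE// ler_nat ltnS leq_addr.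
Qed.

(** The quotient is at most the mean of [1, ..., 1 / (N + 1)], which tends to 0 by Cesaro. *)
Lemma cvg_harmonic_sum_mean {R : realType} :
  (fun N => harmonic_sum N / N.+1%:R : R) @ \oo --> (0 : R).
Proof.
apply: (@squeeze_cvgr _ _ _ _ (fun=> 0) (arithmetic_mean harmonic)).
- near=> N; rewrite divr_ge0//=; last by apply: sumr_ge0 => k _; rewrite invr_ge0.
  rewrite /arithmetic_mean/= mulrC ler_pM2l ?invr_gt0//.
  by rewrite /series/= big_mkord big_ord_recr/= lerDl invr_ge0.
- exact: cvg_cst.
- exact/cesaro/cvg_harmonic.
Unshelve. all: by end_near. Qed.

(** The indices above [x] give the first harmonic sum and those below it the second, with a minus
    sign; at [y = x] the convention [0^-1 = 0] applies. *)
Lemma sum_inv_sub {R : realType} x d :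
  \sum_(y < x.+1 + d) (y.+1%:R - x.+1%:R)^-1 = harmonic_sum d - harmonic_sum x :> R.
Proof.
rewrite big_split_ord/= big_ord_recr/= subrr invr0 addr0 addrC; congr (_ + _).
  apply: eq_bigr => k _; congr (_^-1).
  by rewrite -natrB ?ltnS; [congr (_%:R); lia|lia].
rewrite (reindex_inj rev_ord_inj)/= -sumrN; apply: eq_bigr => k _.
rewrite -invrN; congr (_^-1); rewrite -[LHS]opprK opprB -natrB; last by have := ltn_ord k; lia.
by congr (- _%:R); have := ltn_ord k; lia.
Qed.

Lemma sum_inv_add {R : realType} x N :
  \sum_(y < N) (y.+1%:R + x.+1%:R)^-1 = harmonic_sum (x.+1 + N) - harmonic_sum x.+1 :> R.
Proof.
rewrite harmonic_sumD addrAC subrr add0r; apply: eq_bigr => k _.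
by rewrite -natrD; congr (_%:R^-1); lia.
Qed.

(* The term [y = x] contributes nothing, since [0^-1 = 0]. *)
Definition sqr_sub_sum {R : realType} (N x : nat) : R :=
  \sum_(y < N) (y.+1%:R ^+ 2 - x.+1%:R ^+ 2)^-1.

(** Partial fractions with [a = x + 1]. The coefficient [3/4] is [1/2], from the term [1 / a] of the
    harmonic sum up to [a], plus [1/4], from the excluded index [y = x]. *)
Lemma sqr_sub_sumE {R : realType} x d :
  sqr_sub_sum (x.+1 + d) x = 3 / 4 * (x.+1%:R ^+ 2)^-1 -
   (2 * x.+1%:R)^-1 * (harmonic_sum (d + 2 * x.+1) - harmonic_sum d) :> R.
Proof.
have a0 : x.+1%:R != 0 :> R by rewrite pnatr_eq0.
have xN : (x < x.+1 + d)%N by rewrite ltn_addr.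
pose a : R := x.+1%:R.
(* At [y = x] the two fractions leave [- 1 / (4 a^2)] where the original term is 0; the conditional
   summand compensates. *)
transitivity (\sum_(y < x.+1 + d) ((2 * a)^-1 * (y.+1%:R - a)^-1 -
    (2 * a)^-1 * (y.+1%:R + a)^-1 + (if y == Ordinal xN then (4 * a ^+ 2)^-1 else 0))).
  apply: eq_bigr => y _; have [->|yx] := eqVneq.
    by rewrite /= -/a !subrr invr0; field; rewrite (addrC 1) natr1 -natrD !pnatr_eq0.
  have b0 : y.+1%:R - a != 0.
    rewrite subr_eq0 eqr_nat eqSS; apply: contra yx => /eqP yx.
    by apply/eqP/val_inj.
  have c0 : y.+1%:R + a != 0 by rewrite -natrD pnatr_eq0.
  have -> : (y.+1%:R ^+ 2 - a ^+ 2) = (y.+1%:R - a) * (y.+1%:R + a) by ring.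
  rewrite addr0 -mulrBr.
  have -> : (y.+1%:R - a)^-1 - (y.+1%:R + a)^-1 =
     (2 * a) / ((y.+1%:R - a) * (y.+1%:R + a)).
    rewrite -[X in X - _]mul1r -[X in _ - X]mul1r.
    rewrite -mulNr addf_div//; congr (_ / _); ring.
  by rewrite mulrA mulVf ?mul1r// mulf_neq0 // pnatr_eq0.
rewrite !big_split/= sumrN -!mulr_sumr sum_inv_sub sum_inv_add -big_mkcond/= big_pred1_eq.
have -> : (x.+1 + (x.+1 + d) = d + 2 * x.+1)%N by lia.
have -> : harmonic_sum x.+1 = harmonic_sum x + a^-1 by rewrite /harmonic_sum big_ord_recr.
by rewrite -/a; field; rewrite (addrC 1) natr1 pnatr_eq0.
Qed.

(** The difference of harmonic sums has [2 (x + 1)] terms, each at most [1 / (d + 1) = 1 / (N - x)];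
    their number cancels the prefactor. *)
Lemma sqr_sub_sum_bound {R : realType} N x : (x < N)%N ->
  `|sqr_sub_sum N x - 3 / 4 * (x.+1%:R ^+ 2)^-1| <= (N - x)%:R^-1 :> R.
Proof.
move=> xN; have -> : N = (x.+1 + (N - x.+1))%N by lia.
set d := (N - x.+1)%N; rewrite sqr_sub_sumE addrAC subrr add0r normrN normrM.
have /andP[h0 h1] := @harmonic_sumD_bounds R d (2 * x.+1).
have -> : (x.+1 + d - x = d.+1)%N by lia.
rewrite ger0_norm ?invr_ge0 ?mulr_ge0// ger0_norm//.
rewrite mulrC ler_pdivrMr ?mulr_gt0// mulrC.
by apply: (le_trans h1); rewrite natrM.
Qed.

(** A geometric sum. The factor [p q / (p - q)] is written with inverses so that for [p], [q]
    inverse squares it becomes a term of [sqr_sub_sum]. *)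
Lemma sum_mixed_powers {F : fieldType} (p q : F) m : p != 0 -> q != 0 -> p != q ->
  \sum_(i < m) p ^+ i.+1 * q ^+ (m - i) = (q^-1 - p^-1)^-1 * (p ^+ m - q ^+ m).
Proof.
move=> p0 q0 pq.
have pq0 : p - q != 0 by rewrite subr_eq0.
have -> : (q^-1 - p^-1)^-1 = p * q / (p - q).
  have -> : q^-1 - p^-1 = (p - q) / (p * q) by field; rewrite p0 q0.
  by rewrite invf_div.
have -> : p ^+ m - q ^+ m = (p - q) * \sum_(i < m) q ^+ (m.-1 - i) * p ^+ i.
  by rewrite -opprB subrXX -mulNr opprB.
rewrite mulrA divfK// mulr_sumr; apply: eq_bigr => i _.
have -> : (m - i = (m.-1 - i).+1)%N by have := ltn_ord i; lia.
by rewrite !exprS; ring.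
Qed.

(** After exchanging the sums, the diagonal [x = y] gives the first term. Off the diagonal, [D] is
    antisymmetric, so the parts with [q x ^+ m] and [q y ^+ m] have equal sums, hence the factor
    2. *)
Lemma sum_zeta_sum_mul {R : realType} m N :
  \sum_(i < m) zeta_sum (2 * i.+1) N * zeta_sum (2 * (m - i)) N =
  m%:R * zeta_sum (2 * m.+1) N +
  2 * \sum_(x < N) (x.+1%:R ^+ (2 * m))^-1 * sqr_sub_sum N x :> R.
Proof.
pose q (x : 'I_N) : R := (x.+1%:R ^+ 2)^-1.
have qX (x : 'I_N) k : (x.+1%:R ^+ (2 * k))^-1 = q x ^+ k by rewrite exprM -exprVn.
have q0 (x : 'I_N) : q x != 0 by rewrite invr_eq0 expf_neq0// pnatr_eq0.
pose D (x y : 'I_N) : R := (y.+1%:R ^+ 2 - x.+1%:R ^+ 2)^-1.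
have DN x y : D y x = - D x y by rewrite /D -invrN opprB.
transitivity (\sum_(x < N) \sum_(y < N) \sum_(i < m) q x ^+ i.+1 * q y ^+ (m - i)).
  under [RHS]eq_bigr do rewrite exchange_big/=.
  rewrite [RHS]exchange_big/=; apply: eq_bigr => i _.
  rewrite /zeta_sum big_distrlr/=.
  by apply: eq_bigr => x _; apply: eq_bigr => y _; rewrite !qX.
transitivity (\sum_(x < N) \sum_(y < N)
   ((if y == x then m%:R * q x ^+ m.+1 else 0) + D x y * q x ^+ m + D y x * q y ^+ m)).
  apply: eq_bigr => x _; apply: eq_bigr => y _; have [->|yx] := eqVneq.
    rewrite /D subrr invr0 !mul0r !addr0 mulr_natl -[X in _ *+ X](card_ord m) -sumr_const.
    apply: eq_bigr => i _; by rewrite -exprD addSn subnKC// ltnW// ltn_ord.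
  rewrite sum_mixed_powers//; last first.
    apply: contra yx => /eqP/invr_inj/eqP; rewrite eqrXn2// eqr_nat eqSS => /eqP xy.
    by apply/eqP/val_inj.
  have -> : ((q y)^-1 - (q x)^-1)^-1 = D x y by rewrite /q !invrK.
  by rewrite add0r (DN x y) mulrBr mulNr.
under eq_bigr do rewrite !big_split/=.
rewrite !big_split/= -addrA; congr (_ + _).
  rewrite mulr_sumr; apply: eq_bigr => x _; rewrite -big_mkcond/= big_pred1_eq qX//.
rewrite [X in _ + X]exchange_big/= mulr_natl mulr2n; congr (_ + _).
  by apply: eq_bigr => x _; rewrite qX /sqr_sub_sum mulr_sumr; apply: eq_bigr => y _; rewrite mulrC.
by apply: eq_bigr => x _; rewrite qX /sqr_sub_sum mulr_sumr; apply: eq_bigr => y _; rewrite mulrC.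
Qed.

(** Uses [1 / (a b) = (1 / a + 1 / b) / (a + b)] with the constant sum [a + b = N + 1]. *)
Lemma sum_inv_mul_rev {R : realType} N :
  \sum_(x < N) x.+1%:R^-1 / (N - x)%:R = 2 * (harmonic_sum N / N.+1%:R) :> R.
Proof.
transitivity (\sum_(x < N) N.+1%:R^-1 * (x.+1%:R^-1 + (N - x)%:R^-1) : R).
  apply: eq_bigr => x _; have xN := ltn_ord x.
  have -> : N.+1%:R = x.+1%:R + (N - x)%:R :> R by rewrite -natrD; congr (_%:R); lia.
  have a0 : 0 < x.+1%:R :> R by [].
  have b0 : 0 < (N - x)%:R :> R by rewrite ltr0n subn_gt0.
  move: (x.+1%:R : R) ((N - x)%:R : R) a0 b0 => a b a0 b0.
  by field; rewrite !gt_eqF// addr_gt0.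
rewrite -mulr_sumr big_split/= [X in _ + X](reindex_inj rev_ord_inj)/=.
have -> : \sum_(k < N) (N - (N - k.+1))%:R^-1 = harmonic_sum N :> R.
  by apply: eq_bigr => k _; rewrite subKn.
by rewrite /harmonic_sum; ring.
Qed.

(** The main part [3/4] of [sqr_sub_sum] raises the coefficient [m] to [m + 3/2]. In the remainder,
    [0 < m] allows bounding [1 / (x+1)^(2m)] by [1 / (x+1)], which leaves the sum of
    [sum_inv_mul_rev]. *)
Lemma zeta_sum_recurrence_error {R : realType} m N : (0 < m)%N ->
  `|\sum_(i < m) zeta_sum (2 * i.+1) N * zeta_sum (2 * (m - i)) N -
    (m.+1%:R + 2^-1) * zeta_sum (2 * m.+1) N| <= 4 * (harmonic_sum N / N.+1%:R) :> R.
Proof.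
move=> m0; rewrite sum_zeta_sum_mul.
have -> : m%:R * zeta_sum (2 * m.+1) N +
  2 * (\sum_(x < N) (x.+1%:R ^+ (2 * m))^-1 * sqr_sub_sum N x) -
  (m.+1%:R + 2^-1) * zeta_sum (2 * m.+1) N =
  2 * \sum_(x < N) (x.+1%:R ^+ (2 * m))^-1 *
     (sqr_sub_sum N x - 3 / 4 * (x.+1%:R ^+ 2)^-1) :> R.
  under [in RHS]eq_bigr do rewrite mulrBr.
  rewrite sumrB.
  have -> : \sum_(x < N) (x.+1%:R ^+ (2 * m))^-1 * (3 / 4 * (x.+1%:R ^+ 2)^-1) =
      3 / 4 * zeta_sum (2 * m.+1) N :> R.
    rewrite mulr_sumr; apply: eq_bigr => x _.
    by rewrite mulrCA -invfM -exprD mulnS addnC.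
  by rewrite -natr1; field.
have -> : 4 * (harmonic_sum N / N.+1%:R) = 2 * (2 * (harmonic_sum N / N.+1%:R)) :> R by ring.
rewrite normrM ger0_norm// ler_pM2l// -sum_inv_mul_rev.
apply: (le_trans (ler_norm_sum _ _ _)); apply: ler_sum => x _.
rewrite normrM ler_pM//; last exact: sqr_sub_sum_bound.
rewrite ger0_norm ?invr_ge0 ?exprn_ge0// lef_pV2 ?posrE ?exprn_gt0//.
by rewrite -[leLHS]expr1 ler_weXn2l ?ler1n// muln_gt0.
Qed.

Lemma zeta_even_recurrence {R : realType} m : (0 < m)%N ->
  \sum_(i < m) zeta (2 * i.+1)%N%:R * zeta (2 * (m - i))%N%:R =
  (m.+1%:R + 2^-1) * zeta (2 * m.+1)%N%:R :> R.
Proof.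
move=> m0; apply/eqP; rewrite -subr_eq0; apply/eqP.
pose u N : R := \sum_(i < m) zeta_sum (2 * i.+1) N * zeta_sum (2 * (m - i)) N -
    (m.+1%:R + 2^-1) * zeta_sum (2 * m.+1) N.
apply: (@cvg_unique _ (@norm_hausdorff _ R) (u @ \oo)).
  apply: cvgB; last by apply: cvgM; [exact: cvg_cst|apply: cvg_zeta_sum; lia].
  apply: cvg_big => [|i _]; first exact: add_continuous.
  have im := ltn_ord i.
  by apply: cvgM; apply: cvg_zeta_sum; lia.
apply: norm_cvg0; apply: (@squeeze_cvgr _ _ _ _ (fun=> 0)
    (fun N => 4 * (harmonic_sum N / N.+1%:R))).
- by near=> N; rewrite normr_ge0/= zeta_sum_recurrence_error.
- exact: cvg_cst.
- rewrite -[X in _ --> X](mulr0 4); apply: cvgM; first exact: cvg_cst.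
  exact: cvg_harmonic_sum_mean.
Unshelve. all: by end_near. Qed.

(** * Bernoulli numbers *)

(** Convergence at one point [rho] bounds [c k * rho ^+ k], so for [|t| < rho / 2] the tail is
    dominated by a geometric series of ratio at most [1/2]. *)
Lemma pseries_remainder {R : realType} (c : nat -> R) (f : R -> R) N :
  (\forall t \near (0 : R)^', pseries c t @ \oo --> f t) ->
  exists C, \forall t \near (0 : R)^', `|f t - (\poly_(k < N) c k).[t]| <= C * `|t| ^+ N.
Proof.
move=> /nbhs_ballP[e /= e0 cf].
pose rho := e / 2.
have rho0 : 0 < rho by rewrite divr_gt0.
have crho : cvgn (series (fun k => c k * rho ^+ k)).
  apply/cvg_ex; exists (f rho); apply: cf; last by rewrite gt_eqF.
  by rewrite /ball/= sub0r normrN gtr0_norm// /rho; lra.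
have [M [Mreal Mbnd]] := cvg_seq_bounded (cvgP _ (cvg_series_cvg_0 crho)).
pose K := `|M| + 1.
have K0 : 0 < K by rewrite ltr_wpDl.
have bnd k : `|c k| * rho ^+ k <= K.
  rewrite -[rho ^+ k]gtr0_norm ?exprn_gt0// -normrM.
  by apply: Mbnd => //; rewrite /K (le_lt_trans (ler_norm _))// ltrDl.
exists (2 * K / rho ^+ N); near=> t.
have t0 : t != 0 by near: t; exact: nbhs_dnbhs_neq.
have tr : `|t| < rho / 2.
  near: t; apply: nbhs_dnbhs; apply/nbhs_ballP; exists (rho / 2) => /=.
    by rewrite divr_gt0.
  by move=> y; rewrite /ball/= sub0r normrN.
have ct : pseries c t @ \oo --> f t.
  apply: cf => //; rewrite /ball/= sub0r normrN (lt_trans tr)//.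
  by rewrite /rho; lra.
set x := `|t| / rho.
have x0 : 0 <= x by rewrite divr_ge0// ltW.
have x2 : x <= 1 / 2 by rewrite ler_pdivrMr//; lra.
have ck k : `|c k * t ^+ k| <= K * x ^+ k.
  rewrite normrM normrX /x expr_div_n mulrA ler_pdivlMr ?exprn_gt0//.
  by rewrite mulrAC ler_wpM2r ?exprn_ge0.
(* The subtracted term makes the bound inductive, since [2 x <= 1]. *)
have geo m : \sum_(k < m) x ^+ k <= 2 - 2 * x ^+ m.
  elim: m => [|m IH]; first by rewrite big_ord0 expr0; lra.
  rewrite big_ord_recr/= (le_trans (lerD IH (lexx _)))//.
  rewrite exprS; have : 0 <= x ^+ m by exact: exprn_ge0.
  by move: (x ^+ m) => y y0; nra.
have part n : (N <= n)%N ->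
    `|pseries c t n - (\poly_(k < N) c k).[t]| <= 2 * K / rho ^+ N * `|t| ^+ N.
  move=> Nn; rewrite horner_poly /pseries/= /series/= -(big_mkord xpredT (fun k => c k * t ^+ k)).
  rewrite (big_cat_nat (leq0n N) Nn)//= addrC addrK.
  rewrite -{1}(add0n N) big_addn big_mkord.
  apply: (le_trans (ler_norm_sum _ _ _)).
  apply: (@le_trans _ _ (\sum_(i < n - N) K * x ^+ N * x ^+ i)).
    apply: ler_sum => i _; apply: (le_trans (ck _)).
    by rewrite exprD mulrA mulrAC.
  rewrite -mulr_sumr.
  have -> : 2 * K / rho ^+ N * `|t| ^+ N = K * x ^+ N * 2.
    by rewrite /x (expr_div_n `|t|); ring.
  apply: ler_wpM2l; first by rewrite mulr_ge0 ?exprn_ge0// ltW.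
  by rewrite (le_trans (geo _))// gerBl mulr_ge0 ?exprn_ge0.
have cn : (fun n => `|pseries c t n - (\poly_(k < N) c k).[t]|) @ \oo -->
    `|f t - (\poly_(k < N) c k).[t]|.
  by apply: cvg_norm; apply: cvgB => //; exact: cvg_cst.
rewrite -(cvg_lim _ cn)//; apply: limr_le; first exact: cvgP cn.
by exists N => // n /= Nn; exact: part.
Unshelve. all: by end_near. Qed.

Lemma cvg_horner0 {R : realType} (p : {poly R}) : p.[t] @[t --> (0 : R)^'] --> p`_0.
Proof.
rewrite -horner_coef0; apply: cvg_within_filter.
exact: continuous_horner.
Qed.

(** The constant coefficient is the limit at 0, hence zero; dividing by [t], which is nonzero on the
    punctured neighbourhood, lowers [N] by one. *)
Lemma coef_eq0_of_bigO {R : realType} (p : {poly R}) N C :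
  (\forall t \near (0 : R)^', `|p.[t]| <= C * `|t| ^+ N) ->
  forall k, (k < N)%N -> p`_k = 0.
Proof.
elim: N p => [//|N IH] p pC.
have p0 : p`_0 = 0.
  apply: (@cvg_unique _ (@norm_hausdorff _ R) (p.[t] @[t --> (0 : R)^'])).
    exact: cvg_horner0.
  apply: norm_cvg0; apply: (@squeeze_cvgr _ _ _ _ (fun=> 0)
      (fun t => C * `|t| ^+ N.+1)).
  - by near=> t; rewrite normr_ge0/=; near: t.
  - exact: cvg_cst.
  - rewrite -[X in _ --> X](mulr0 C); apply: cvgM; first exact: cvg_cst.
    have := @cvg_horner0 R ('X^(N.+1)); rewrite coefXn/= => /cvg_norm; rewrite normr0.
    by under eq_fun do rewrite hornerXn normrX.
have [q pq] : exists q, p = q * 'X.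
  have /factor_theorem[q ->] : root p 0 by rewrite rootE horner_coef0 p0.
  by exists q; rewrite subr0.
move=> [//|k] kN; rewrite pq coefMX/=; apply: IH => //.
near=> t; have t0 : t != 0 by near: t; exact: nbhs_dnbhs_neq.
have : `|p.[t]| <= C * `|t| ^+ N.+1 by near: t.
rewrite pq hornerM hornerX normrM exprSr mulrA ler_pM2r// normr_gt0//.
Unshelve. all: by end_near. Qed.

Lemma horner_bounded_near0 {R : realType} (p : {poly R}) :
  exists2 K, 0 <= K & \forall t \near (0 : R)^', `|p.[t]| <= K.
Proof.
exists (`|p`_0| + 1); first by rewrite addr_ge0.
have /cvgrPdist_lt/(_ 1 ltr01) := @cvg_horner0 R p.
apply: filterS => t pt; rewrite -[p.[t]](subrKC p`_0).
rewrite (le_trans (ler_normD _ _))// lerD2l distrC ltW//.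
Qed.

Lemma cvg_pseries_expR {R : realType} (t : R) :
  pseries (fun k => k`!%:R^-1) t @ \oo --> expR t.
Proof.
rewrite (_ : pseries _ t = series (exp_coeff t)); first exact: is_cvg_series_exp_coeff.
by apply/funext => n; apply: eq_bigr => i _; rewrite /exp_coeff/= mulrC.
Qed.

(** Turns the analytic definition into algebra: [(e^t - 1) * (t / (e^t - 1)) = t] survives
    truncation of both factors up to [O(t^N)], so the coefficients below [N] agree. *)
Lemma bernoulli_poly_mul {R : realType} (B : nat -> R) N : bernoulli_numbers B ->
  forall k, (k < N)%N ->
  ((\poly_(i < N) i`!%:R^-1 - 1) * \poly_(i < N) (B i / i`!%:R) - 'X)`_k = 0 :> R.
Proof.
move=> hB; set P := \poly_(i < N) (B i / _); set E := _ - 1.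
have [C1 h1] : exists C, \forall t \near (0 : R)^',
    `|expR t - (\poly_(i < N) i`!%:R^-1).[t]| <= C * `|t| ^+ N.
  by apply: pseries_remainder; near=> t; exact: cvg_pseries_expR.
have [C2 h2] := pseries_remainder N hB.
have [K1 K10 hE] := horner_bounded_near0 E.
have [K2 K20 hP] := horner_bounded_near0 P.
apply: (@coef_eq0_of_bigO _ _ _ (K1 * `|C2| + `|C1| * (K2 + `|C2|))).
near=> t.
have t0 : t != 0 by near: t; exact: nbhs_dnbhs_neq.
have t1 : `|t| <= 1.
  near: t; apply: nbhs_dnbhs; apply/nbhs_ballP; exists 1 => //= y.
  by rewrite /ball/= sub0r normrN => /ltW.
have tN : `|t| ^+ N <= 1 by apply: exprn_ile1.
have h1' : `|E.[t] - (expR t - 1)| <= `|C1| * `|t| ^+ N.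
  have -> : E.[t] - (expR t - 1) = (\poly_(i < N) i`!%:R^-1).[t] - expR t.
    by rewrite /E hornerD hornerN -polyC1 hornerC; ring.
  rewrite distrC.
  apply: (@le_trans _ _ (C1 * `|t| ^+ N)); first by near: t.
  by rewrite ler_wpM2r ?exprn_ge0// ler_norm.
have h2' : `|P.[t] - t / (expR t - 1)| <= `|C2| * `|t| ^+ N.
  rewrite distrC; apply: (@le_trans _ _ (C2 * `|t| ^+ N)); first by near: t.
  by rewrite ler_wpM2r ?exprn_ge0// ler_norm.
have hE' : `|E.[t]| <= K1 by near: t.
have hP' : `|P.[t]| <= K2 by near: t.
have e1 : expR t - 1 != 0 by rewrite subr_eq0 -expR0 (inj_eq (@expR_inj R)).
rewrite hornerD hornerN hornerX hornerM.
set f := t / (expR t - 1) in h2' *.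
have -> : E.[t] * P.[t] - t = E.[t] * (P.[t] - f) + (E.[t] - (expR t - 1)) * f.
  have tf : t = (expR t - 1) * f by rewrite /f mulrC divfK.
  by rewrite [X in _ - X = _]tf; ring.
have fK : `|f| <= K2 + `|C2|.
  rewrite -[f](subKr P.[t]) (le_trans (ler_normB _ _))// lerD//.
  by apply: (le_trans h2'); rewrite ler_piMr.
rewrite (le_trans (ler_normD _ _))// [leRHS]mulrDl lerD//.
  by rewrite normrM -mulrA ler_pM.
by rewrite [leLHS]normrM mulrAC ler_pM.
Unshelve. all: by end_near. Qed.

(* With [E = e^X - 1] and [P = X / E], differentiating [E P = X] and using
   [E' = E + 1] gives Euler's equation [P^2 + X P + X P' = P]; it holds up to
   order [M] for the truncated series. *)
Lemma bernoulli_euler {R : realType} (b : nat -> R) :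
  (forall N k, (k < N)%N ->
    ((\poly_(i < N) i`!%:R^-1 - 1) * \poly_(i < N) b i - 'X)`_k = 0) ->
  forall k, \sum_(i < k.+2) b i * b (k.+1 - i)%N + b k + k.+1%:R * b k.+1 = b k.+1.
Proof.
move=> hb k; pose M := k.+2.
have := hb M.+1; set P := \poly_(i < _) b i; set E := _ - 1.
set F := _ - 'X => F0.
(* The product is exactly [X] plus a multiple of [X^(M+1)], which can be differentiated. *)
have FQ : E * P = 'X + drop_poly M.+1 F * 'X^(M.+1).
  have T0 : take_poly M.+1 F = 0.
    by apply/polyP => i; rewrite coef_take_poly coef0; case: ifP => // /F0.
  have := poly_take_drop M.+1 F; rewrite T0 add0r => ->.
  by rewrite /F addrC subrK.
move: (drop_poly _ _) FQ => Q FQ.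
(* Differentiating the truncated exponential loses its top term. *)
have dE : E^`() = E + 1 - M`!%:R^-1 *: 'X^M.
  apply/polyP => i; rewrite /E subrK derivB derivC subr0 coef_deriv coefB coefZ.
  rewrite coefXn !coef_poly ltnS; case: ltngtP => [iM|iM|->].
  - rewrite ltnW// mulr0 subr0 factS natrM -mulr_natr; field.
    by rewrite addrC natr1 !pnatr_eq0 -lt0n fact_gt0.
  - by rewrite ltnS leqNgt iM mul0rn mulr0 subr0.
  - by rewrite mul0rn ltnSn mulr1 subrr.
have dF : E^`() * P + E * P^`() = 1 + (Q^`() * 'X^(M.+1) + Q * ('X^M *+ M.+1)).
  by rewrite -derivM FQ derivD derivX derivM derivXn.
pose c := M`!%:R^-1 : R.
(* [dF] is multiplied by [P] and [E * P] replaced through [FQ]; every error term is a multiple of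
   [X^M], invisible in the coefficient [k + 1 < M]. *)
have eu : P * P + 'X * P + 'X * P^`() - P =
   (c *: (P * P) - Q * 'X * P^`() + P * Q^`() * 'X + P * Q *+ M.+1 - Q * 'X * P) * 'X^M.
  have := congr1 (fun p => P * p) dF; rewrite dE -/c.
  have -> : P * ((E + 1 - c *: 'X^M) * P + E * P^`()) =
    E * P * P + P * P - c *: (P * P * 'X^M) + E * P * P^`().
    by rewrite -!mul_polyC; ring.
  rewrite FQ -!mul_polyC -2!(mulr_natr _ M.+1) exprS => h.
  apply/eqP; rewrite -subr_eq0; move/eqP: h; rewrite -subr_eq0 => /eqP h.
  by apply/eqP; rewrite -[RHS]h; ring.
have := congr1 (fun p : {poly R} => p`_k.+1) eu.
rewrite /= coefMXn ltnSn coefB !coefD coefM !coefXM/= coef_deriv !coef_poly !ltnS leqW ?leqnSn//.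
move=> /eqP; rewrite subr_eq0 => /eqP.
under eq_bigr => i _.
  rewrite !coef_poly (leq_trans (ltn_ord i))// ltnS (leq_trans (leq_subr _ _))//; over.
have -> : (k <= M)%N by rewrite /M; lia.
by rewrite mulr_natl.
Qed.

Section bernoulli_recurrence.
Context {R : realType} (B : nat -> R) (hB : bernoulli_numbers B).
Let b k := B k / k`!%:R.

Let b_euler k :
  \sum_(i < k.+2) b i * b (k.+1 - i)%N + b k + k.+1%:R * b k.+1 = b k.+1.
Proof. by apply: bernoulli_euler => N k' kN; exact: bernoulli_poly_mul. Qed.

Let b0 : b 0%N = 1.
Proof.
have := bernoulli_poly_mul (N := 2) hB (ltnSn 1).
rewrite coefB coefX coefM !big_ord_recl big_ord0/= !coefB !coef1 !coef_poly/= -/(b 0) -/(b 1).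
by rewrite !fact0 !invr1 subrr mul0r add0r addr0 subr0 mul1r => /eqP; rewrite subr_eq0 => /eqP.
Qed.

Let b1 : b 1%N = - 2^-1.
Proof.
have := b_euler 0; rewrite !big_ord_recl big_ord0/= b0.
by move: (b 1) => y; lra.
Qed.

Let b2 : b 2%N = 12^-1.
Proof.
have := b_euler 1; rewrite !big_ord_recl big_ord0/= /bump/= b0 b1.
by move: (b 2) => y; lra.
Qed.

(** Two terms are split off [b_euler] at each end; with [b 0 = 1] and [b 1 = - 1/2], everything in
    [b m.+2] cancels. *)
Let b_rec m : \sum_(i < m) b i.+2 * b (m.+1 - i)%N = - (m.+4%:R * b m.+3).
Proof.
have := b_euler m.+2; rewrite big_ord_recl big_ord_recl !big_ord_recr/=.
rewrite /bump/= !add1n subn0 subn1 subnn subSnn/= b0 b1.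
under eq_bigr do rewrite !add1n subSS subSS.
move: (\sum_(i < m) _) => s; rewrite -(natr1 m.+3).
by move: (b m.+3) (b m.+2) (m.+3%:R) => x y z h; lra.
Qed.

(** In [b_rec] the two indices are at least 2 and add up to [2n + 3], so one of them is odd, at
    least 3 and smaller than [2n + 3]. *)
Let b_odd n : b (2 * n + 3)%N = 0.
Proof.
elim/ltn_ind: n => n IH.
have := b_rec (2 * n); rewrite big1 => [/esym/eqP|i _].
  by rewrite oppr_eq0 mulf_eq0 pnatr_eq0/= => /eqP; rewrite addn3.
have iN := ltn_ord i; have [oi|ei] := boolP (odd i).
  rewrite (_ : i.+2 = 2 * i./2 + 3)%N; last by have := odd_double_half i; rewrite oi; lia.
  by rewrite IH ?mul0r//; have := odd_double_half i; rewrite oi; lia.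
have hi := odd_double_half i; rewrite (negbTE ei) add0n in hi.
rewrite (_ : (2 * n).+1 - i = 2 * (n - i./2).-1 + 3)%N; last by lia.
by rewrite IH ?mulr0//; lia.
Qed.

Lemma bernoulli_even_recurrence m : (0 < m)%N ->
  \sum_(i < m) b (2 * i.+1) * b (2 * (m - i)) = - ((2 * m + 3)%:R * b (2 * m.+1)).
Proof.
case: m => // m _; have := b_rec (2 * m).+1.
have -> : ((2 * m).+1.+4 = 2 * m.+1 + 3)%N by lia.
have -> : ((2 * m).+1.+3 = 2 * m.+2)%N by lia.
move=> <-.
have split_even (F : nat -> R) k : (forall j, F (2 * j).+1 = 0) ->
    \sum_(i < (2 * k).+1) F i = \sum_(j < k.+1) F (2 * j)%N.
  move=> F0; elim: k => [|k IH]; first by rewrite muln0 !big_ord1.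
  rewrite big_ord_recr [in RHS]big_ord_recr/= -IH mulnS !add2n big_ord_recr/=.
  by rewrite F0 addr0.
rewrite (split_even (fun i => b i.+2 * b ((2 * m).+2 - i)%N)).
  by apply: eq_bigr => i _; congr (b _ * b _); lia.
by move=> j; rewrite (_ : (2 * j).+3 = 2 * j + 3)%N ?b_odd ?mul0r//; lia.
Qed.

(** Strong induction through the two recurrences. The factors [- (-1)^n (2 pi)^(2n) / 2] of two
    indices with sum [n] multiply to [- 1/2] times the factor of [n], which cancels against
    [- (2m + 3) = - 2 (m + 1 + 1/2)]. *)
Lemma zeta_even n : (0 < n)%N ->
  zeta (2 * n)%N%:R = - (-1) ^+ n * (2 * pi) ^+ (2 * n) * b (2 * n) / 2 :> R.
Proof.
elim/ltn_ind: n => -[//|m] IH _; have [->|m0] := posnP m.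
  by rewrite muln1 zeta2 b2; field.
have mz : m.+1%:R + 2^-1 != 0 :> R by rewrite gt_eqF// ltr_wpDl.
apply: (mulfI mz); rewrite -zeta_even_recurrence//.
transitivity (\sum_(i < m) ((-1) ^+ m.+1 * (2 * pi) ^+ (2 * m.+1) / 4) *
    (b (2 * i.+1) * b (2 * (m - i)))).
  apply: eq_bigr => i _; have im := ltn_ord i.
  rewrite !IH//; [|lia..].
  have -> : m.+1 = (i.+1 + (m - i))%N by lia.
  rewrite mulnDr !exprD.
  by field.
rewrite -mulr_sumr bernoulli_even_recurrence//.
have -> : (2 * m + 3)%:R = 2 * (m.+1%:R + 2^-1) :> R.
  by rewrite natrD natrM -natr1; field.
by field.
Qed.

(** Zeta is nonnegative here, so taking absolute values removes the sign [- (-1)^n]. *)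
Lemma zeta_even_norm n : (0 < n)%N ->
  zeta (2 * n)%N%:R = pi ^+ (2 * n) * (2 ^+ (2 * n - 1) * `|B (2 * n)|) / (2 * n)`!%:R :> R.
Proof.
move=> n0; have z0 : 0 <= @zeta R (2 * n)%N%:R.
  by rewrite (le_trans ler01)// zeta_ge1//; lia.
rewrite -[LHS]ger0_norm// zeta_even// /b !normrM normrN normr_sign mul1r.
rewrite [`|_ ^+ _|]ger0_norm ?exprn_ge0 ?mulr_ge0 ?pi_ge0//.
rewrite !normfV !normr_nat exprMn.
have -> : (2 : R) ^+ (2 * n) = 2 * 2 ^+ (2 * n - 1) by rewrite -exprS; congr (_ ^+ _); lia.
by field; rewrite pnatr_eq0 -lt0n fact_gt0.
Qed.

End bernoulli_recurrence.

(** * The radius, the Catalan numbers and the conclusion *)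

Lemma bernoulli_radiusX {R : realType} (B : nat -> R) n : (0 < n)%N ->
  bernoulli_radius B n ^+ (4 * n) = 2 ^+ (2 * n - 1) * `|B (2 * n)%N|.
Proof.
move=> n0; rewrite -powR_mulrn ?powR_ge0// -powRrM mulVf ?powRr1//.
by rewrite pnatr_eq0 muln_eq0 -lt0n.
Qed.

Lemma catalan_fact {R : realType} n :
  n`!%:R * n.+1`!%:R * catalan n = (2 * n)`!%:R :> R.
Proof.
have nn : (n <= 2 * n)%N by lia.
have n1 : n.+1%:R != 0 :> R by rewrite pnatr_eq0.
rewrite -(bin_fact nn) (_ : 2 * n - n = n)%N; last by lia.
rewrite /catalan factS !natrM.
rewrite [X in _ * X * _]mulrC -!mulrA [X in _ * (_ * X)]mulrA mulfV// mul1r.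
by rewrite mulrA mulrC.
Qed.

Theorem proposition3 (R : realType) (B : nat -> R) (n : nat)
    (hB : bernoulli_numbers B) (hn : (1 <= n)%N) :
  let r : R := bernoulli_radius B n in
  [/\ zeta (2 * n)%N%:R =
        pi ^+ (2 * n)%N * r ^+ (4 * n)%N /
          (n`!%:R * n.+1`!%:R * catalan n),
      catalan n =
        pi ^+ (2 * n)%N * r ^+ (4 * n)%N /
          (n`!%:R * n.+1`!%:R * zeta (2 * n)%N%:R)
    & lebesgue_tuple (4 * n)%N (closed_euclidean_ball r) =
        (zeta (2 * n)%N%:R)%:E ].
Proof.
move=> r.
have z0 : zeta (2 * n)%N%:R != 0 :> R.
  by rewrite gt_eqF// (lt_le_trans ltr01)// zeta_ge1//; lia.
have n0 : n`!%:R != 0 :> R by rewrite pnatr_eq0 -lt0n fact_gt0.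
have n1 : n.+1`!%:R != 0 :> R by rewrite pnatr_eq0 -lt0n fact_gt0.
have zE : zeta (2 * n)%N%:R = pi ^+ (2 * n) * r ^+ (4 * n) / (2 * n)`!%:R.
  by rewrite (zeta_even_norm hB hn) /r bernoulli_radiusX.
have r0 : 0 <= r by exact: powR_ge0.
split; first by rewrite catalan_fact.
- have -> : pi ^+ (2 * n) * r ^+ (4 * n) = zeta (2 * n)%N%:R * (2 * n)`!%:R.
    by rewrite zE divfK// pnatr_eq0 -lt0n fact_gt0.
  by rewrite -catalan_fact; field; rewrite z0 n0 n1.
(* Of [r] only [r0] and [zE] are kept; the volume formula applies with half dimension [2 * n]. *)
- move: r r0 zE; rewrite (_ : 4 * n = 2 * (2 * n))%N; last by lia.
  by move=> r r0 ->; rewrite lebesgue_ball_even.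
Qed.
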